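(* Let $\mathcal{F}$ be a class of $m$-Lipschitz functions $\mathcal{X}\to\mathcal{Y}$, let $\ell(y,y')=|y-y'|^p$ for some $p\ge 1$, and let $\eta>0$. For any $f\in\widetilde{\mathcal{F}}_\eta$ and each $x$ with $p_X(x)>0$, $$f(x)\in\big[\,l^{(m)}_{\mathcal{D}\to x}-r_\eta(x),\ u^{(m)}_{\mathcal{D}\to x}+s_\eta(x)\,\big],$$ where $r_\eta(x)=r$ such that $\mathbb{E}_X\big[(r-lg^{(m)}_{X\to x})_+^p\big]=\eta$, and $s_\eta(x)=s$ such that $\mathbb{E}_X\big[(s-ug^{(m)}_{X\to x})_+^p\big]=\eta$.
   Context: $\mathcal{X}$ is a feature space (a subset of a normed space) and $\mathcal{Y}\subseteq\mathbb{R}$ a label space. Each $x$ carries a fixed interval $[l_x,u_x]$; $\mathcal{D}_I$ is the distribution of $(X,L,U)$ with $L=l_X$, $U=u_X$, and $p_X$ is the density of $X$ (the letter $p$ alone is the exponent of the loss). The true label $f^*(x)$ lies in $[l_x,u_x]$. Distributions are assumed nonatomic in this sense: at every point with positive density, every ball around it contains a set of positive probability. The projection loss is $\pi_\ell(f(x),l,u)=\min_{\tilde y\in[l,u]}\ell(f(x),\tilde y)$, and $\widetilde{\mathcal{F}}_\eta=\{f\in\mathcal{F}:\mathbb{E}[\pi_\ell(f(X),L,U)]\le\eta\}$. $m$-Lipschitz: $|f(x)-f(x')|\le m\|x-x'\|$ for all $f\in\mathcal{F}$, $x,x'\in\mathcal{X}$. $l^{(m)}_{x'\to x}=l_{x'}-m\|x-x'\|$,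 $u^{(m)}_{x'\to x}=u_{x'}+m\|x-x'\|$; $l^{(m)}_{\mathcal{D}\to x}=\sup_{p_X(x')>0}l^{(m)}_{x'\to x}$ and $u^{(m)}_{\mathcal{D}\to x}=\inf_{p_X(x')>0}u^{(m)}_{x'\to x}$ (the endpoints of $\bigcap_{p_X(x')>0}[l^{(m)}_{x'\to x},u^{(m)}_{x'\to x}]$), understood to be finite. The lower and upper bound gaps are $lg^{(m)}_{x'\to x}=l^{(m)}_{\mathcal{D}\to x}-l^{(m)}_{x'\to x}$ and $ug^{(m)}_{x'\to x}=u^{(m)}_{x'\to x}-u^{(m)}_{\mathcal{D}\to x}$. $c_+=\max(0,c)$. *)

(* Defs.v *)
From HB Require Import structures.
From mathcomp Require Import all_boot all_order all_algebra.
From mathcomp Require Import all_classical all_reals all_analysis.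

Set Implicit Arguments.
Unset Strict Implicit.
Unset Printing Implicit Defensive.

Import Order.TTheory GRing.Theory Num.Theory.
Import numFieldNormedType.Exports.

Local Open Scope classical_set_scope.
Local Open Scope ring_scope.

Notation borel V := (g_sigma_algebraType (@open V)).

Definition power_loss (R : realType) (p : R) (y y' : R) : R := `|y - y'| `^ p.

(* The infimum is attained for the losses of interest, see [proj_loss_min]. *)
Definition proj_loss (R : realType) (ell : R -> R -> R) (y l u : R) : R :=
  inf [set ell y t | t in `[l, u]].

Lemma proj_loss_min (R : realType) (p y l u : R) : 0 <= p -> l <= u ->
  exists t, [/\ l <= t <= u, proj_loss (power_loss p) y l u = power_loss p y t &
    forall t', l <= t' <= u -> power_loss p y t <= power_loss p y t'].
Proof.
move=> p0 lu; pose t := Num.min u (Num.max l y).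
have tlu : l <= t <= u by rewrite /t le_min lu le_max lexx ge_min lexx.
have tmin t' : l <= t' <= u -> power_loss p y t <= power_loss p y t'.
  move=> /andP[lt' t'u]; rewrite /power_loss ge0_ler_powR ?nnegrE //.
  rewrite /t; have [ly|yl] := leP l y.
    have [uy|yu] := leP u y; last by rewrite subrr normr0.
    have t'y := le_trans t'u uy.
    by rewrite !ger0_norm ?subr_ge0// lerD2l lerN2.
  rewrite min_r// ![`|y - _|]distrC.
  by rewrite !ger0_norm ?subr_ge0 ?(ltW yl) ?lerD2r// (le_trans (ltW yl)).
exists t; split => //; apply/eqP; rewrite eq_le; apply/andP; split.
  apply: ge_inf; last by exists t => //=; rewrite in_itv.
  by exists (power_loss p y t) => _ [t' /=] + <-; rewrite in_itv => /tmin.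
apply: lb_le_inf.
  by exists (power_loss p y t), t => //=; rewrite in_itv.
by move=> _ [t' /=] + <-; rewrite in_itv => /tmin.
Qed.

Definition F_tilde (d : measure_display) (T : measurableType d) (R : realType)
    (P : probability T R) (V : Type) (ell : R -> R -> R)
    (X : T -> V) (L U : T -> R) (F : set (V -> R)) (eta : R) : set (V -> R) :=
  [set f | F f /\
    ('E_P[fun w => proj_loss ell (f (X w)) (L w) (U w)] <= eta%:E)%E].

(* In all the definitions below, [S] is the set of points of the feature space
   with positive density, and the source point [x'] comes before the target
   point [x]. *)
Section lipschitz_intervals.
Context {R : realType} {V : normedModType R}.
Implicit Types (m : R) (l u : V -> R) (S : set V) (x : V).

Definition lip_lower m l (x' x : V) : R := l x' - m * `|x - x'|.
Definition lip_upper m u (x' x : V) : R := u x' + m * `|x - x'|.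

Definition lower_set m l S x : set R := [set lip_lower m l x' x | x' in S].
Definition upper_set m u S x : set R := [set lip_upper m u x' x | x' in S].

(* Real-valued suprema and infima: they are only meaningful when [lower_set] is
   bounded above and [upper_set] is bounded below. *)
Definition lowerD m l S x : R := sup (lower_set m l S x).
Definition upperD m u S x : R := inf (upper_set m u S x).

Definition lower_gap m l S (x' x : V) : R := lowerD m l S x - lip_lower m l x' x.
Definition upper_gap m u S (x' x : V) : R := lip_upper m u x' x - upperD m u S x.

End lipschitz_intervals.

(* [r_eta] and [s_eta] are the solutions of [r_eqn] and [s_eqn]; they are junk
   where the equation has no unique solution. *)
Section slack_equations.
Context {d : measure_display} {T : measurableType d} {R : realType}.
Context {V : normedModType R}.
Implicit Types (P : probability T R) (X : T -> V).

Definition r_eqn P X (p m : R) (l : V -> R) (S : set V) (eta : R) (x : V)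
    (r : R) : Prop :=
  ('E_P[fun w => (Num.max 0 (r - lower_gap m l S (X w) x) `^ p)%R] = eta%:E)%E.

Definition s_eqn P X (p m : R) (u : V -> R) (S : set V) (eta : R) (x : V)
    (s : R) : Prop :=
  ('E_P[fun w => (Num.max 0 (s - upper_gap m u S (X w) x) `^ p)%R] = eta%:E)%E.

Definition r_eta P X p m l S eta x : R := get (r_eqn P X p m l S eta x).
Definition s_eta P X p m u S eta x : R := get (s_eqn P X p m u S eta x).

End slack_equations.

(* Main.v *)
(** Fix [x] and set [phi r = E (r - lg)_+^p], where [lg >= 0] almost surely is
the lower gap between [X] and [x].  Then [phi] is finite and continuous (dominated
convergence), vanishes on the nonpositive reals, and [phi r / r] is nondecreasing
on the positive ones because [(r' - lg)_+ >= (r' / r) (r - lg)_+] for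
[r' >= r > 0]; hence [phi r = eta] has exactly one solution and [phi] is strictly
increasing past it.  If [f] is [m]-Lipschitz and [c] is the amount by which
[f x] lies below the lower endpoint at [x], then [f (X)] lies at least
[c - lg] below [l_X], so the projection loss dominates [(c - lg)_+^p].  Thus
[phi c <= eta], i.e. [c <= r_eta x].  The upper bound is symmetric. *)

Require Import Defs.
From HB Require Import structures.
From mathcomp Require Import all_boot all_order all_algebra.
From mathcomp Require Import all_classical all_reals all_analysis.
From mathcomp Require Import measurable_realfun lra.

Set Implicit Arguments.
Unset Strict Implicit.
Unset Printing Implicit Defensive.

Import Order.TTheory GRing.Theory Num.Theory.
Import numFieldNormedType.Exports.

Local Open Scope classical_set_scope.
Local Open Scope ring_scope.

(** * Powers of positive parts, and monotonicity of the expectation *)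

Lemma pospart_ge0 (R : realType) (a : R) : 0 <= Num.max 0 a.
Proof. by rewrite le_max lexx. Qed.

Lemma pospart_powR_le (R : realType) (p a b : R) : 0 <= p -> a <= b ->
  Num.max 0 a `^ p <= Num.max 0 b `^ p.
Proof.
move=> p0 ab; apply: (ge0_ler_powR p0); rewrite ?nnegrE ?pospart_ge0//.
by rewrite ge_max !le_max lexx/= ab orbT.
Qed.

Lemma continuous_pospart_powR (R : realType) (p : R) : 1 <= p ->
  continuous (fun a : R => Num.max 0 a `^ p).
Proof.
move=> p1 /= a; have p0 : 0 < p by exact: lt_le_trans p1.
have [a0|a0] := ltP 0 a.
  apply: (@cvg_trans _ ((b `^ p) @[b --> a])).
    apply: near_eq_cvg; near=> b; rewrite max_r// ltW//.
    by near: b; exact: lt_nbhsr.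
  rewrite max_r ?ltW//.
  have da : derivable (fun b : R^o => b `^ p : R^o) a 1.
    by apply: derivable_powR; rewrite in_itv/= a0.
  exact: (differentiable_continuous ((derivable1_diffP _ _).1 da)).
have v0 : Num.max 0 a `^ p = 0 by rewrite max_l// powR0// gt_eqF.
rewrite /continuous_at v0; apply/cvgrPdist_lt => e e0; near=> b.
rewrite sub0r normrN ger0_norm ?powR_ge0//.
(* Since [a <= 0], the positive part of [b] is at most [|a - b|]. Once this is below 1, raising to
   the power [p >= 1] does not increase it, so [e] itself serves as the radius. *)
have ba : Num.max 0 b <= `|a - b|.
  rewrite ge_max normr_ge0/= distrC (le_trans _ (ler_norm _))//.
  by rewrite lerBrDr gerDl.
have ab1 : `|a - b| < 1 by near: b; apply: (@nbhsx_ballx _ R^o a).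
have abe : `|a - b| < e by near: b; apply: (@nbhsx_ballx _ R^o a).
move: ba; have [_ _|b0 ba] := leP b 0; first by rewrite powR0// gt_eqF.
apply: le_lt_trans (le_lt_trans ba abe).
by rewrite ge1r_powR// b0/= (le_trans ba)// ltW.
Unshelve. all: by end_near. Qed.

(* No measurability assumption: the functions of [F] are only Lipschitz on [XX],
   which is not assumed measurable, so the projection loss need not be measurable. *)
Lemma ge0_le_integral_nomeas d (T : measurableType d) (R : realType)
    (mu : {measure set T -> \bar R}) (f g : T -> \bar R) :
  (forall x, 0 <= f x)%E -> (forall x, f x <= g x)%E ->
  (\int[mu]_x f x <= \int[mu]_x g x)%E.
Proof.
move=> f0 fg; have g0 x : (0 <= g x)%E by exact: le_trans (fg x).
rewrite !ge0_integralTE//; apply: le_ereal_sup => _ [h hf <-]; exists h => // x.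
exact: le_trans (fg x).
Qed.

Lemma expectation_le_nomeas d (T : measurableType d) (R : realType)
    (P : probability T R) (f g : T -> R) :
  (forall x, 0 <= f x) -> (forall x, f x <= g x) -> ('E_P[f] <= 'E_P[g])%E.
Proof.
move=> f0 fg; rewrite unlock.
by apply: ge0_le_integral_nomeas => x; rewrite lee_fin.
Qed.

Lemma measurable_pospart_powR d (T : measurableType d) (R : realType)
    (G : T -> R) (p r : R) : measurable_fun setT G ->
  measurable_fun setT (fun w => Num.max 0 (r - G w) `^ p).
Proof.
move=> mG; apply: (measurableT_comp (f := @powR R ^~ p)) => //.
apply: (measurable_maxr (f := cst 0) (g := fun w => r - G w)) => //.
exact: measurable_funB.
Qed.

(** * Moments of the positive part of [r - G] for an everywhere nonnegative [G] *)

Section pospart_moment.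
Context d (T : measurableType d) (R : realType) (P : probability T R).
Variables (G : T -> R) (p : R).
Hypotheses (mG : measurable_fun setT G) (G0 : forall w, 0 <= G w) (p1 : 1 <= p).

Local Notation phi r := ('E_P[fun w => (Num.max 0 (r - G w) `^ p)%R])%E.

Let p0 : 0 < p. Proof. exact: lt_le_trans p1. Qed.

Let mphi r : measurable_fun setT (fun w => Num.max 0 (r - G w) `^ p).
Proof. exact: measurable_pospart_powR. Qed.

Let phi_ub r w : Num.max 0 (r - G w) `^ p <= Num.max 0 r `^ p.
Proof.
by apply: (pospart_powR_le (ltW p0)); rewrite gerBl.
Qed.

Let integrable_phi r :
  P.-integrable setT (EFin \o (fun w => Num.max 0 (r - G w) `^ p)).
Proof.
apply: (@le_integrable _ _ _ P _ measurableT _ (EFin \o cst (Num.max 0 r `^ p))).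
- exact/measurable_EFinP.
- by move=> w _; rewrite lee_fin !ger0_norm ?powR_ge0.
- exact: finite_measure_integrable_cst.
Qed.

Let phi_fin r : phi r \is a fin_num.
Proof. 
by rewrite unlock; apply: integrable_fin_num => //; exact: integrable_phi.
Qed.

Lemma pospart_moment_le0 r : r <= 0 -> phi r = 0%E.
Proof.
move=> r0; rewrite unlock integral0_eq// => w _.
by rewrite max_l ?powR0 ?gt_eqF// subr_le0 (le_trans r0).
Qed.

(** With [k = r' / r >= 1]: [k * a^p <= (k * a)^p] for [a >= 0] because [p >= 1], and
    [k * (r - G) <= r' - G] because [G >= 0]. *)
Lemma pospart_moment_scale r r' : 0 < r -> r <= r' ->
  ((r' / r)%:E * phi r <= phi r')%E.
Proof.
move=> r0 rr'; have k1 : 1 <= r' / r by rewrite ler_pdivlMr// mul1r.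
have k0 : 0 <= r' / r by exact: le_trans k1.
rewrite unlock -ge0_integralZl_EFin//=; last 2 first.
- by move=> w _; rewrite lee_fin powR_ge0.
- exact/measurable_EFinP.
apply: ge0_le_integral_nomeas => w.
  by rewrite lee_fin mulr_ge0// powR_ge0.
rewrite lee_fin; apply: le_trans (le1r_powRZ k1 (pospart_ge0 _) p1) _.
rewrite maxr_pMr// mulr0; apply: (pospart_powR_le (ltW p0)).
by rewrite mulrBr divfK ?gt_eqF// lerD2l lerN2 ler_peMl.
Qed.

Lemma pospart_moment_lt r r' : (0 < phi r)%E -> r < r' -> (phi r < phi r')%E.
Proof.
move=> phir rr'; have r0 : 0 < r.
  by rewrite ltNge; apply/negP => /pospart_moment_le0 h; rewrite h ltxx in phir.
apply: lt_le_trans (pospart_moment_scale r0 (ltW rr')).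
rewrite -(fineK (phi_fin r)) -EFinM lte_fin ltr_pMl ?ltr_pdivlMr ?mul1r//.
by rewrite fine_gt0// phir ltey_eq phi_fin.
Qed.

(** The sets where [G <= n] exhaust the space, so one of them has positive probability. On it the
    positive part of [n + 1 - G] is at least 1, so [phi (n + 1)] is at least this probability. *)
Let phi_gt0 : exists2 r, 0 < r & (0 < phi r)%E.
Proof.
have [[n Gn]|nG] := pselect (exists n : nat, P [set w | G w <= n%:R] != 0%E).
  exists n.+1%:R => //.
  pose A := [set w | G w <= n%:R].
  have mA : measurable A.
    by rewrite -[X in measurable X]setTI; exact: measurable_fun_le.
  have indic_gt0 : (0 < 'E_P[\1_A])%E.
    by rewrite expectation_indic// lt_neqAle eq_sym Gn measure_ge0.
  apply: lt_le_trans indic_gt0 _; apply: expectation_le_nomeas => w; first by [].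
  rewrite indicE; have [|_] := boolP (_ \in _); last exact: powR_ge0.
  rewrite inE/= => Gwn.
  have h : 1 <= Num.max 0 (n.+1%:R - G w).
    by rewrite le_max -natr1 lerBrDr addrC lerD2r Gwn orbT.
  by apply: le_trans h (le1r_powR h p1).
suff : P setT = 0%E by rewrite probability_setT => /eqP; rewrite onee_eq0.
have -> : setT = \bigcup_n [set w | G w <= n%:R].
  apply/seteqP; split => // w _; exists (Num.truncn (G w)).+1 => //=.
  by rewrite ltW// truncnS_gt.
have mA n : measurable [set w | G w <= n%:R].
  by rewrite -[X in measurable X]setTI; exact: measurable_fun_le.
apply/negligibleP; first exact: bigcupT_measurable.
apply: negligible_bigcup => n; apply/negligibleP => //.
by apply/eqP/negPn/negP => Gn; apply: nG; exists n.
Qed.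

Lemma pospart_moment_exists_unique eta : 0 < eta ->
  exists! r, phi r = eta%:E.
Proof.
move=> eta0.
(* Dominated convergence on []a - 1, a + 1[], with the constant bound given by [r < a + 1] and
   [G >= 0]. *)
have cphi : continuous (fun r => \int[P]_(w in setT) (Num.max 0 (r - G w) `^ p)).
  move=> a; apply: (@continuity_under_integral _ _ _ P
      (fun r w => Num.max 0 (r - G w) `^ p) _ measurableT (a - 1) (a + 1) _ _
      (cst (Num.max 0 (a + 1) `^ p))) => //.
  - apply: aeW => w _ r _.
    apply: (@continuous_comp _ _ _ (fun r => r - G w) (fun b => Num.max 0 b `^ p)).
      by apply: cvgB; [exact: cvg_id|exact: cvg_cst].
    exact: continuous_pospart_powR.
  - exact: finite_measure_integrable_cst.
  - move=> r; rewrite /= in_itv/= => /andP[_ ra]; apply: aeW => w _.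
    rewrite ger0_norm ?powR_ge0//; apply: le_trans (phi_ub r w) _.
    exact: (pospart_powR_le (ltW p0) (ltW ra)).
  - by rewrite inE/= in_itv/= ltrDl gtrBl ltr01.
have phiE r : phi r = (\int[P]_(w in setT) (Num.max 0 (r - G w) `^ p))%:E.
  by rewrite /Rintegral unlock fineK//; have := phi_fin r; rewrite unlock.
have [r0 r00 phir0] := phi_gt0.
(* Chosen so that the scaling bound gives [phi M >= (1 + eta / phi r0) * phi r0 = phi r0 + eta]. *)
pose M := r0 * (1 + eta / fine (phi r0)).
have f0 : 0 < fine (phi r0) by rewrite fine_gt0// phir0 ltey_eq phi_fin.
have phiM : (eta%:E <= phi M)%E.
  have r0M : r0 <= M by rewrite ler_peMr ?(ltW r00)// lerDl divr_ge0// ltW.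
  apply: le_trans (pospart_moment_scale r00 r0M).
  have -> : M / r0 = 1 + eta / fine (phi r0) by rewrite /M mulrC mulKf ?gt_eqF.
  rewrite -[X in (_ * X)%E](fineK (phi_fin r0)) -EFinM lee_fin.
  by rewrite mulrDl mul1r divfK ?gt_eqF// lerDr ltW.
have phi0 : phi 0 = 0%E by exact: pospart_moment_le0.
have M0 : 0 <= M by rewrite mulr_ge0 ?ltW// addr_gt0// divr_gt0.
rewrite !phiE in phi0 phiM; case: phi0 => phi0.
have [|r _ phir] := @IVT R _ 0 M eta M0 (continuous_subspaceT cphi).
  move: phiM; rewrite lee_fin => phiM.
  by rewrite phi0 ge_min le_max (ltW eta0) phiM orbT.
exists r; split; first by rewrite phiE phir.
(* Two solutions cannot be strictly ordered: [phi] increases strictly from any point where it is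
   positive, and [eta > 0]. *)
have lt_neq a b : phi a = eta%:E -> phi b = eta%:E -> a < b -> False.
  by move=> ha hb /pospart_moment_lt; rewrite ha hb ltxx lte_fin => /(_ eta0).
move=> r' phir'; have phir1 : phi r = eta%:E by rewrite phiE phir.
have [rr'|rr'|//] := ltgtP r r'.
- by case: (lt_neq r r').
- by case: (lt_neq r' r).
Qed.

End pospart_moment.

(** * Passage to an almost surely nonnegative [G] *)

Section ae_pospart_moment.
Context d (T : measurableType d) (R : realType) (P : probability T R).
Variables (G : T -> R) (p : R).
Hypotheses (mG : measurable_fun setT G) (G0 : {ae P, forall w, 0 <= G w}).
Hypothesis p1 : 1 <= p.

(** A version of [G] that is nonnegative everywhere and almost surely equal to it, hence with the
    same moments. *)
Let Gpos w := Num.max 0 (G w).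

Let mGpos : measurable_fun setT Gpos.
Proof. exact: (measurable_maxr (f := cst 0) (g := G)). Qed.

Let momentE r : ('E_P[fun w => (Num.max 0 (r - G w) `^ p)%R] =
  'E_P[fun w => (Num.max 0 (r - Gpos w) `^ p)%R])%E.
Proof.
rewrite unlock; apply: ae_eq_integral => //.
- exact/measurable_EFinP/measurable_pospart_powR.
- exact/measurable_EFinP/measurable_pospart_powR.
- by apply: filterS G0 => w Gw _; rewrite /Gpos (max_r Gw).
Qed.

Lemma ae_pospart_moment_exists_unique eta : 0 < eta ->
  exists! r, ('E_P[fun w => (Num.max 0 (r - G w) `^ p)%R] = eta%:E)%E.
Proof.
move=> eta0.
have Gpos0 w : 0 <= Gpos w by exact: pospart_ge0.
have [r [hr ur]] := pospart_moment_exists_unique P mGpos Gpos0 p1 eta0.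
by exists r; split => [|r']; rewrite momentE// => /ur.
Qed.

Lemma ae_pospart_moment_solution_ge eta r c : 0 < eta ->
  ('E_P[fun w => (Num.max 0 (r - G w) `^ p)%R] = eta%:E)%E ->
  ('E_P[fun w => (Num.max 0 (c - G w) `^ p)%R] <= eta%:E)%E -> c <= r.
Proof.
rewrite !momentE => eta0 hr hc; rewrite leNgt; apply/negP => rc.
have := pospart_moment_lt (P := P) mGpos (fun w => pospart_ge0 (G w)) p1 _ rc.
by rewrite hr lte_fin => /(_ eta0); rewrite ltNge hc.
Qed.

End ae_pospart_moment.

(** * The projection loss, the density and the gaps *)

(** In either case [c] is at most the distance from [y] to every point of [[l, u]], in particular to
    the minimizer [t]. *)
Lemma pospart_le_proj_loss (R : realType) (p c y l u : R) : 0 <= p -> l <= u ->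
  c <= l - y \/ c <= y - u -> Num.max 0 c `^ p <= proj_loss (power_loss p) y l u.
Proof.
move=> p0 lu cyu; have [t [/andP[lt tu] -> _]] := proj_loss_min y p0 lu.
rewrite /power_loss (ge0_ler_powR p0) ?nnegrE ?pospart_ge0// ge_max normr_ge0/=.
case: cyu => /le_trans; apply.
  by rewrite distrC (le_trans _ (ler_norm _))// lerB.
by rewrite (le_trans _ (ler_norm _))// lerB.
Qed.

Lemma measurable_borel_dist d (T : measurableType d) (R : realType)
    (V : normedModType R) (X : T -> borel V) (x : V) :
  measurable_fun setT X -> measurable_fun setT (fun w => `|x - X w| : R).
Proof.
move=> mX; apply: (measurableT_comp (f := fun y : borel V => `|x - (y : V)|)) => //.
(* Open rays generate the Borel sets of the line, and their preimages under the continuous distance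
   to [x] are open. *)
apply: (measurability _ (RGenOInfty.measurableE R)) => _ [_ [a ->] <-].
rewrite setTI; apply: sub_sigma_algebra.
apply: (@open_comp _ _ (fun y : V => `|x - y|)); last exact: rray_open.
by move=> y _; apply: cvg_norm; apply: cvgB; [exact: cvg_cst|exact: cvg_id].
Qed.

(** The set where the density vanishes has mass the integral of zero. *)
Lemma ae_density_gt0 d (T : measurableType d) (R : realType)
    (P : probability T R) d' (T' : measurableType d') (X : {RV P >-> T'})
    (mu : {measure set T' -> \bar R}) (g : T' -> R) :
  measurable_fun setT g -> (forall x, 0 <= g x) ->
  (forall A, measurable A ->
    distribution P X A = (\int[mu]_(x in A) (g x)%:E)%E) ->
  {ae P, forall w, 0 < g (X w)}.
Proof.
move=> mg g0 hg.
have mA : measurable [set x | g x <= 0].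
  by rewrite -[X in measurable X]setTI; exact: measurable_fun_le.
exists (X @^-1` [set x | g x <= 0]); split.
- by rewrite -[X in measurable X]setTI; exact: measurable_funP.
- have := hg _ mA; rewrite integral0_eq// => x /= gx.
  by congr EFin; apply/eqP; rewrite eq_le gx g0.
- by move=> w /= /negP; rewrite -leNgt.
Qed.

Lemma lower_gap_ge0 (R : realType) (V : normedModType R) (m : R) (l : V -> R)
    (S : set V) (x' x : V) :
  has_ubound (lower_set m l S x) -> S x' -> 0 <= lower_gap m l S x' x.
Proof.
by move=> ub Sx'; rewrite subr_ge0; apply: ub_le_sup => //; exists x'.
Qed.

Lemma upper_gap_ge0 (R : realType) (V : normedModType R) (m : R) (u : V -> R)
    (S : set V) (x' x : V) :
  has_lbound (upper_set m u S x) -> S x' -> 0 <= upper_gap m u S x' x.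
Proof.
by move=> lb Sx'; rewrite subr_ge0; apply: ge_inf => //; exists x'.
Qed.

(** * The interval that contains [f x] *)

Theorem theorem3p6 (R : realType) (V : normedModType R)
  (* feature space and label space *)
  (XX : set V) (YY : set R)
  (* intervals and true label *)
  (l u fstar : V -> R)
  (hfstar : set_fun XX YY fstar)
  (hlu : forall x, XX x -> l x <= fstar x <= u x)
  (* the random triple (X, L, U) *)
  (d : measure_display) (T : measurableType d) (P : probability T R)
  (X : {RV P >-> borel V}) (L U : {RV P >-> R})
  (hX : forall w, XX (X w))
  (hL : forall w, L w = l (X w))
  (hU : forall w, U w = u (X w))
  (* density of X with respect to a reference measure *)
  (mu : {measure set (borel V) -> \bar R}) (pX : borel V -> R)
  (pX_meas : measurable_fun setT pX)
  (pX_ge0 : forall x, 0 <= pX x)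
  (hpX : forall A : set (borel V), measurable A ->
    distribution P X A = (\int[mu]_(x in A) (pX x)%:E)%E)
  (* nonatomicity *)
  (hnonatomic : forall x : V, XX x -> 0 < pX x ->
    forall e : R, 0 < e -> exists A : set (borel V),
      [/\ measurable A, A `<=` ball x e & (0 < distribution P X A)%E])
  (* class of m-Lipschitz functions, loss, eta *)
  (m : R) (F : set (V -> R))
  (hF : forall f, F f -> set_fun XX YY f /\ m.-lipschitz_XX f)
  (p : R) (hp : 1 <= p) (eta : R) (heta : 0 < eta)
  (* finiteness of the endpoints *)
  (hfinl : forall x, XX x -> 0 < pX x ->
    has_ubound (lower_set m l [set x' | XX x' /\ 0 < pX x'] x))
  (hfinu : forall x, XX x -> 0 < pX x ->
    has_lbound (upper_set m u [set x' | XX x' /\ 0 < pX x'] x)) :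
  let S := [set x' : V | XX x' /\ 0 < pX x'] in
  forall f, F_tilde P (power_loss p) X L U F eta f ->
  forall x, XX x -> 0 < pX x ->
  [/\ (* r_eta and s_eta are well defined *)
      exists! r, r_eqn P X p m l S eta x r,
      exists! s, s_eqn P X p m u S eta x s &
      f x \in `[lowerD m l S x - r_eta P X p m l S eta x,
                upperD m u S x + s_eta P X p m u S eta x] ].
Proof.
move=> S f [Ff loss_le] x XXx pXx.
have p0 : 0 <= p by exact: le_trans hp.
have [_ f_lip] := hF _ Ff.
have lipf y z : XX y -> XX z -> f y - f z <= m * `|z - y|.
  move=> XXy XXz; rewrite (distrC z) (le_trans (ler_norm _))//.
  exact: (f_lip (y, z) (conj XXy XXz)).
have mX := measurable_borel_dist x (measurable_funP X).
have aeS : {ae P, forall w, S (X w)}.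
  by apply: filterS (ae_density_gt0 pX_meas pX_ge0 hpX) => w ?; split.
have lu y : XX y -> l y <= u y by move=> /hlu /andP[]; exact: le_trans.
have lg_ae : {ae P, forall w, 0 <= lower_gap m l S (X w) x}.
  by apply: filterS aeS => w /(lower_gap_ge0 (hfinl _ XXx pXx)).
have ug_ae : {ae P, forall w, 0 <= upper_gap m u S (X w) x}.
  by apply: filterS aeS => w /(upper_gap_ge0 (hfinu _ XXx pXx)).
have mlg : measurable_fun setT (fun w => lower_gap m l S (X w) x).
  (* [l] composed with [X] is measurable because it is the random variable [L]. *)
  rewrite /lower_gap /lip_lower; under eq_fun do rewrite -hL.
  apply: measurable_funB => //; apply: measurable_funB => //.
  exact: measurable_funM.
have mug : measurable_fun setT (fun w => upper_gap m u S (X w) x).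
  rewrite /upper_gap /lip_upper; under eq_fun do rewrite -hU.
  apply: measurable_funB => //; apply: measurable_funD => //.
  exact: measurable_funM.
have ex_r := ae_pospart_moment_exists_unique mlg lg_ae hp heta.
have ex_s := ae_pospart_moment_exists_unique mug ug_ae hp heta.
split => //; rewrite in_itv/=; apply/andP; split.
- have [r [hr _]] := ex_r.
  (* Existence ensures that [get] returns a solution rather than its default value. *)
  have /= hget := @getPex _ (r_eqn P X p m l S eta x) (ex_intro _ r hr).
  rewrite lerBlDr addrC -lerBlDr.
  apply: (ae_pospart_moment_solution_ge mlg lg_ae hp heta hget).
  apply: le_trans loss_le; apply: expectation_le_nomeas => w.
    exact: powR_ge0.
  rewrite hL hU; apply: pospart_le_proj_loss => //; first exact: lu.
  (* With [c = lowerD - f x], the difference [c - lower_gap] is [l (X w) - m * |x - X w| - f x], at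
     most [l (X w) - f (X w)] by the Lipschitz bound. *)
  left; have := lipf _ _ (hX w) XXx; rewrite /lower_gap /lip_lower; lra.
- have [s [hs _]] := ex_s.
  have /= hget := @getPex _ (s_eqn P X p m u S eta x) (ex_intro _ s hs).
  rewrite addrC -lerBlDr.
  apply: (ae_pospart_moment_solution_ge mug ug_ae hp heta hget).
  apply: le_trans loss_le; apply: expectation_le_nomeas => w.
    exact: powR_ge0.
  rewrite hL hU; apply: pospart_le_proj_loss => //; first exact: lu.
  right; have := lipf _ _ XXx (hX w).
  rewrite distrC /upper_gap /lip_upper; lra.
Qed.
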